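(* The norm $\|\cdot\|_{\mathrm{Mult}(\mathcal{D}),2}$ and the supremum norm on $\mathbb{D}$ are not equivalent on the space of functions that are holomorphic in a neighborhood of $\overline{\mathbb{D}}$.
   Context: $\mathbb{D}$ is the open unit disc in $\mathbb{C}$. $\mathcal{D}$ is the classical Dirichlet space, i.e. the reproducing kernel Hilbert space on $\mathbb{D}$ with kernel $K(z,w)=\frac{1}{z\overline{w}}\log\big(\frac{1}{1-z\overline{w}}\big)$ (equal to $1$ when $z\overline w=0$); equivalently the space of holomorphic $f(z)=\sum_{n\ge0}\widehat f(n)z^n$ on $\mathbb{D}$ with $\|f\|^2=\sum_{n\ge0}(n+1)|\widehat f(n)|^2<\infty$. The $2$-point multiplier norm of $\varphi:\mathbb{D}\to\mathbb{C}$ is $$\|\varphi\|_{\mathrm{Mult}(\mathcal{D}),2}=\inf\{C\ge0: [K(x_i,x_j)(C^2-\varphi(x_i)\overline{\varphi(x_j)})]_{i,j=1}^2\text{ is positive semi-definite for all }x_1,x_2\in\mathbb{D}\}$$ (with $+\infty$ if no such $C$ exists). *)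

(* Defs.v *)
From HB Require Import structures.
From mathcomp Require Import all_boot all_order all_algebra.
From mathcomp Require Import complex.
From mathcomp Require Import all_classical all_reals all_analysis.

Set Implicit Arguments.
Unset Strict Implicit.
Unset Printing Implicit Defensive.

Import Order.TTheory GRing.Theory Num.Theory.
Import numFieldNormedType.Exports.

Local Open Scope classical_set_scope.
Local Open Scope ring_scope.
Local Open Scope complex_scope.

Definition unit_disc (R : realType) : set R[i] := [set z | `|z| < 1].

Definition closed_unit_disc (R : realType) : set R[i] := [set z | `|z| <= 1].

(* The modulus as an element of [R]; the library's [`|z|] lives in [R[i]]. *)
Definition cmodulus (R : realType) (z : R[i]) : R := complex.Re `|z|.

(* Principal argument, in ]-pi, pi] for z != 0. *)
Definition cArg (R : realType) (z : R[i]) : R :=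
  let t := acos (complex.Re z / cmodulus z) in
  if 0 <= complex.Im z then t else - t.

(* Principal branch of the logarithm (junk value at 0). *)
Definition cLog (R : realType) (z : R[i]) : R[i] :=
  ln (cmodulus z) +i* cArg z.

Definition dirichlet_kernel (R : realType) (z w : R[i]) : R[i] :=
  let u := z * Num.conj w in
  if u == 0 then 1 else u^-1 * cLog (1 / (1 - u)).

(* In [R[i]], [0 <= a] says that [a] is real and nonnegative; a complex matrix
   with this property is therefore automatically Hermitian. *)
Definition pos_semidef (R : realType) (n : nat) (A : 'M[R[i]]_n) : Prop :=
  forall v : 'I_n -> R[i],
    0 <= \sum_(i < n) \sum_(j < n) Num.conj (v i) * A i j * v j.

(* The n-point multiplier norm, on the domain D, of the space with reproducing
   kernel K; it is +oo when no admissible constant exists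
   ([ereal_inf set0 = +oo]). Only the values of phi on D matter. *)
Definition mult_norm (R : realType) (D : set R[i]) (K : R[i] -> R[i] -> R[i])
    (n : nat) (phi : R[i] -> R[i]) : \bar R :=
  ereal_inf [set C%:E | C in [set C : R | 0 <= C /\
    forall x : 'I_n -> R[i], (forall i, D (x i)) ->
      pos_semidef (\matrix_(i < n, j < n)
        (K (x i) (x j) *
          (C%:C ^+ 2 - phi (x i) * Num.conj (phi (x j)))))]].

Definition dirichlet_mult_norm (R : realType) (n : nat)
    (phi : R[i] -> R[i]) : \bar R :=
  mult_norm (@unit_disc R) (@dirichlet_kernel R) n phi.

Definition sup_norm (R : realType) (D : set R[i]) (f : R[i] -> R[i]) : \bar R :=
  ereal_sup [set (cmodulus (f z))%:E | z in D].

(* The regular module [R[i]^o] carries the usual topology of the complex plane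
   and its structure of normed space over [R[i]], so that derivability in the
   direction 1 is complex differentiability. *)
Definition holomorphic_on (R : realType) (U : set R[i]) (f : R[i] -> R[i]) :
    Prop :=
  forall z : R[i], U z -> derivable (f : R[i]^o -> R[i]^o) z 1.

Definition holomorphic_near (R : realType) (A : set R[i]) (f : R[i] -> R[i]) :
    Prop :=
  exists U : set R[i]^o, [/\ open U, A `<=` U & holomorphic_on U f].

(* Equivalence, on a space E of functions, of two (possibly infinite) norms. *)
Definition equivalent_norms (R : realType) (E : set (R[i] -> R[i]))
    (N1 N2 : (R[i] -> R[i]) -> \bar R) : Prop :=
  exists c C : R, [/\ 0 < c, 0 < C &
    forall f, E f -> (c%:E * N1 f <= N2 f)%E /\ (N2 f <= C%:E * N1 f)%E].

(* Main.v *)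
Require Import Defs.
From mathcomp Require Import all_boot all_order all_algebra.
From mathcomp Require Import complex.
From mathcomp Require Import all_classical all_reals all_analysis.
From mathcomp Require Import ring lra.

Set Implicit Arguments.
Unset Strict Implicit.
Unset Printing Implicit Defensive.

Import Order.TTheory GRing.Theory Num.Theory.
Import numFieldNormedType.Exports.

Local Open Scope classical_set_scope.
Local Open Scope ring_scope.
Local Open Scope complex_scope.

(** The two norms differ because the Dirichlet kernel blows up only
    logarithmically at the boundary.  Let [s = exp (-1/n)] and
    [phi z = z ^ n - s ^ n].  All these polynomials are bounded by 2 on the disc.
    At the two points [s] and [s ^ 2] the values of [phi] are [0] and [- e],
    where [e = exp (-1) - exp (-2)] does not depend on [n].

    With [L x = - ln (1 - x)], the kernel at [(s ^ i, s ^ j)] is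
    [L (s ^ (i + j)) / s ^ (i + j)], so the powers of [s] cancel in the 2 x 2
    determinant and positivity of the Pick matrix with constant [C] says that
      [e^2 L(s^2) L(s^4) <= C^2 (L(s^2) L(s^4) - L(s^3)^2)].
    The three values of [L] are nearly equal: [L(s^4) <= L(s^3) <= L(s^2)] by
    monotonicity, and [L(s^2) <= L(s^3) + ln 2] because [1 - s^3] is at most
    twice [1 - s^2].  The right-hand side is thus at most [C^2 L(s^4) ln 2], and
    [e^2 L(s^2) <= C^2 ln 2] ([two_point_bound]).  As [n] grows, [s] tends to 1
    and [L(s^2)] to infinity ([neg_ln1m_unbounded]), hence so does [C].  In other
    words, the normalized kernel functions at [s] and [s ^ 2] become nearly
    parallel, while the values of [phi] there stay apart. *)

(** * The kernel at real points *)

Definition neg_ln1m (R : realType) (x : R) : R := - ln (1 - x).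

(** A form of [fmorphV] in which [%:C] is the plain function, so that it can be
    used as a rewriting rule in both directions. *)
Lemma real_complexV (R : realType) (x : R) : (x^-1)%:C = (x%:C)^-1.
Proof. exact: (fmorphV (real_complex R)). Qed.

Lemma norm_real_complex (R : realType) (x : R) :
  `|x%:C| = `|x|%:C :> R[i].
Proof. by rewrite normc_def /= expr0n /= addr0 sqrtr_sqr. Qed.

Lemma cLog_real (R : realType) (p : R) : 0 < p -> cLog p%:C = (ln p)%:C.
Proof.
move=> p0; rewrite /cLog /cArg /cmodulus normc_def /= expr0n /= addr0 lexx.
by rewrite sqrtr_sqr gtr0_norm// divff ?gt_eqF// acos1.
Qed.

Lemma dirichlet_kernel_real (R : realType) (x y : R) :
  0 < x -> 0 < y -> x * y < 1 ->
  dirichlet_kernel x%:C y%:C = (neg_ln1m (x * y) / (x * y))%:C.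
Proof.
move=> x0 y0 xy1.
have xy0 : 0 < x * y by exact: mulr_gt0.
have yC : Num.conj (y%:C : R[i]) = y%:C by exact: conjc_real.
rewrite /dirichlet_kernel yC -rmorphM /=.
have -> : ((x * y)%:C == 0 :> R[i]) = false.
  by rewrite fmorph_eq0 gt_eqF.
have -> : 1 / (1 - (x * y)%:C) = ((1 - x * y)^-1)%:C :> R[i].
  by rewrite div1r -[in LHS](rmorph1 (real_complex R)) -rmorphB -real_complexV.
rewrite cLog_real ?invr_gt0 ?subr_gt0// lnV ?posrE ?subr_gt0//.
by rewrite mulrC -real_complexV -rmorphM.
Qed.

(** Real vectors carry all the information used here: at [(- b, a)] the form takes
    the value [a (a d - b^2)].  Leaving [p] and [q] free lets denominators be
    cleared in the choice of the vector. *)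
Lemma pos_semidef2_real (R : realType) (A : 'M[R[i]]_2) (a b d : R) :
  A 0 0 = a%:C -> A 0 1 = b%:C -> A 1 0 = b%:C -> A 1 1 = d%:C ->
  pos_semidef A ->
  forall p q : R, 0 <= p ^+ 2 * a + p * q * b *+ 2 + q ^+ 2 * d.
Proof.
move=> A00 A01 A10 A11 psdA p q.
have := psdA (fun i => if i == 0 then p%:C else q%:C).
rewrite !big_ord_recl !big_ord0 /= !addr0.
have -> : lift ord0 ord0 = 1 :> 'I_2 by exact/val_inj.
have -> : ord0 = 0 :> 'I_2 by exact/val_inj.
rewrite A00 A01 A10 A11 /=.
have cC (r : R) : Num.conj (r%:C : R[i]) = r%:C by exact: conjc_real.
rewrite !cC -!rmorphM -!rmorphD /= lecR.
congr (0 <= _); ring.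
Qed.

(** * Slow growth of the kernel along powers of a point *)

Section kernel_growth.
Variables (R : realType) (s : R).
Hypotheses (s0 : 0 < s) (s1 : s < 1).

Let pow_lt1 k : s ^+ k.+1 < 1.
Proof. by rewrite exprn_ilt1// ltW. Qed.

Lemma neg_ln1m_gt0 k : 0 < neg_ln1m (s ^+ k.+1).
Proof.
rewrite /neg_ln1m oppr_gt0; apply: ln_lt0.
by rewrite subr_gt0 pow_lt1/= gtrBl exprn_gt0.
Qed.

Lemma neg_ln1m_le k : neg_ln1m (s ^+ k.+2) <= neg_ln1m (s ^+ k.+1).
Proof.
rewrite /neg_ln1m lerN2 ler_ln ?posrE ?subr_gt0 ?pow_lt1// lerB//.
by rewrite exprS ger_pMl ?exprn_gt0// ltW.
Qed.

(** Passing from [s ^ 2] to [s ^ 3] changes the distance to 1 by a bounded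
    factor, hence the logarithm by a bounded amount, uniformly in [s]. *)
Lemma neg_ln1m_sq_le_cube : neg_ln1m (s ^+ 2) <= neg_ln1m (s ^+ 3) + ln 2.
Proof.
rewrite /neg_ln1m lerNl opprD opprK lerBlDr.
rewrite -lnM ?posrE ?subr_gt0 ?pow_lt1//.
rewrite ler_ln ?posrE ?mulr_gt0 ?subr_gt0 ?pow_lt1//.
rewrite -subr_ge0.
have -> : (1 - s ^+ 2) * 2 - (1 - s ^+ 3) = (1 - s) * (1 + s - s ^+ 2) by ring.
rewrite mulr_ge0 ?subr_ge0 ?(ltW s1)//.
have : s ^+ 2 < 1 := pow_lt1 1.
by move: s0; lra.
Qed.

End kernel_growth.

(** From [1 - 2/m <= exp (-2/m)] with [m = n + 1], one gets
    [- ln (1 - exp (-2/m)) >= ln (m/2)]; it exceeds [B] once [m > 2 exp B]. *)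
Lemma neg_ln1m_unbounded (R : realType) (B : R) :
  exists n : nat, B < neg_ln1m (expR (- n.+1%:R^-1) ^+ 2).
Proof.
pose n := Num.truncn (2 * expR B).
exists n.
have lt1 : expR (- n.+1%:R^-1) ^+ 2 < 1 :> R.
  by rewrite exprn_ilt1 ?expR_ge0//.
rewrite /neg_ln1m ltrNr -ltr_expR lnK ?posrE ?subr_gt0// (expRN B).
have h : 1 - expR (- n.+1%:R^-1) ^+ 2 <= 2 / n.+1%:R :> R.
  rewrite -expRM_natr; set h := n.+1%:R^-1.
  have := expR_ge1Dx (- h * 2); lra.
apply: (le_lt_trans h).
rewrite -[ltLHS]invf_div ltf_pV2 ?posrE ?divr_gt0 ?expR_gt0//.
by rewrite ltr_pdivlMr// mulrC truncnS_gt.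
Qed.

(** * The test functions *)

Definition shifted_power (R : realType) (n : nat) (s : R) (z : R[i]) : R[i] :=
  z ^+ n - (s ^+ n)%:C.

(** Over an arbitrary field: the normed module structures involved are then
    found by unification at once, which is not so for a concrete [R[i]]. *)
Lemma derivable_expn_sub_cst (K : numFieldType) (n : nat) (c x v : K) :
  derivable ((fun z => z ^+ n - c) : K^o -> K^o) x v.
Proof.
apply: (@derivableB K K^o K^o (fun z => z ^+ n) (cst c)).
- exact: (@exprn_derivable K n x v).
- exact: (derivable_cst (c : K^o) (x : K^o) (v : K^o)).
Qed.

Lemma shifted_power_holomorphic (R : realType) n (s : R) (A : set R[i]) :
  holomorphic_near A (shifted_power n s).
Proof.
exists setT; split=> //; first exact: openT.
by move=> z _; exact: (@derivable_expn_sub_cst R[i]).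
Qed.

Lemma shifted_power_sup_norm (R : realType) n (s : R) :
  0 <= s <= 1 -> (sup_norm (@unit_disc R) (shifted_power n s) <= 2%:E)%E.
Proof.
move=> /andP[s0 s1]; apply: ge_ereal_sup => _ [z z1 <-].
rewrite lee_fin /cmodulus.
have : `|shifted_power n s z| <= 1 + 1.
  rewrite (le_trans (ler_normB _ _))// lerD//.
    by rewrite normrX exprn_ile1// ltW.
  by rewrite norm_real_complex lecR ger0_norm ?exprn_ge0// exprn_ile1.
have -> : 1 + 1 = 2%:C :> R[i] by rewrite rmorphMn.
by rewrite lecE /= => /andP[].
Qed.

(** * Multiplier norm against supremum norm *)

(** The Pick condition at [s] and [s ^ 2].  Since the test function vanishes at
    [s], the determinant is [K11 K22 C^2 (C^2 - e^2) - K12^2 C^4], where one factor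
    [C^2] comes from the first diagonal entry; using the vector [(K12, - K11)]
    instead of the determinant avoids this factor, and with it the case [C = 0]. *)
Lemma two_point_bound (R : realType) n (s C : R) : 0 < s < 1 ->
  (forall x : 'I_2 -> R[i], (forall i, unit_disc (x i)) ->
    pos_semidef (\matrix_(i < 2, j < 2)
      (dirichlet_kernel (x i) (x j) *
        (C%:C ^+ 2 - shifted_power n s (x i) *
                      Num.conj (shifted_power n s (x j)))))) ->
  (s ^+ n - (s ^+ n) ^+ 2) ^+ 2 * neg_ln1m (s ^+ 2) <= C ^+ 2 * ln 2.
Proof.
move=> /andP[s0 s1] psd.
pose x (i : 'I_2) : R[i] := (s ^+ i.+1)%:C.
have pow0 k : 0 < s ^+ k by exact: exprn_gt0.
have pow1 k : s ^+ k.+1 < 1 by rewrite exprn_ilt1// ltW.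
have xD i : unit_disc (x i).
  by rewrite /unit_disc/= norm_real_complex gtr0_norm// ltcR.
have KE (i j : 'I_2) : dirichlet_kernel (x i) (x j) =
    (neg_ln1m (s ^+ (i.+1 + j.+1)) / s ^+ (i.+1 + j.+1))%:C.
  by rewrite dirichlet_kernel_real// -exprD// addSn pow1.
set e := s ^+ n - (s ^+ n) ^+ 2.
have phi0 : shifted_power n s (x 0) = 0.
  by rewrite /shifted_power /x expr1 rmorphXn subrr.
have phi1 : shifted_power n s (x 1) = (- e)%:C.
  by rewrite /shifted_power /x /e opprB -rmorphXn -rmorphB exprAC.
have conj0 : Num.conj (0 : R[i]) = 0 by exact: conjC0.
have conje : Num.conj ((- e)%:C : R[i]) = (- e)%:C by exact: conjc_real.
have L2 := neg_ln1m_gt0 s0 s1 1.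
have L3 := neg_ln1m_gt0 s0 s1 2.
have L4 := neg_ln1m_gt0 s0 s1 3.
have L32 := neg_ln1m_le s0 s1 1.
have L43 := neg_ln1m_le s0 s1 2.
have L23 := neg_ln1m_sq_le_cube s0 s1.
have CC : (C%:C : R[i]) ^+ 2 = (C ^+ 2)%:C by rewrite rmorphXn.
have := psd x xD; set A := (\matrix_(i, j) _) => psdA.
have AE i j (r : R) :
    shifted_power n s (x i) * Num.conj (shifted_power n s (x j)) = r%:C ->
    A i j = (neg_ln1m (s ^+ (i.+1 + j.+1)) / s ^+ (i.+1 + j.+1)
              * (C ^+ 2 - r))%:C.
  by move=> phiE; rewrite mxE phiE KE CC -rmorphB -rmorphM.
have A00 : A 0 0 = (neg_ln1m (s ^+ 2) / s ^+ 2 * (C ^+ 2 - 0))%:C.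
  by apply: AE; rewrite phi0 mul0r.
have A01 : A 0 1 = (neg_ln1m (s ^+ 3) / s ^+ 3 * (C ^+ 2 - 0))%:C.
  by apply: AE; rewrite phi0 mul0r.
have A10 : A 1 0 = (neg_ln1m (s ^+ 3) / s ^+ 3 * (C ^+ 2 - 0))%:C.
  by apply: AE; rewrite phi0 conj0 mulr0.
have A11 : A 1 1 = (neg_ln1m (s ^+ 4) / s ^+ 4 * (C ^+ 2 - e ^+ 2))%:C.
  by apply: AE; rewrite phi1 conje -rmorphM mulrNN.
(* The vector [(K12, - K11)] multiplied by [s ^ 4], to clear denominators. *)
have := pos_semidef2_real A00 A01 A10 A11 psdA
  (s * neg_ln1m (s ^+ 3)) (- (s ^+ 2 * neg_ln1m (s ^+ 2))).
move: L2 L3 L4 L32 L43 L23.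
set l2 := neg_ln1m (s ^+ 2); set l3 := neg_ln1m (s ^+ 3).
set l4 := neg_ln1m (s ^+ 4) => L2 L3 L4 L32 L43 L23 /= psd0.
have det0 : 0 <= l2 * (l2 * l4 * (C ^+ 2 - e ^+ 2) - l3 ^+ 2 * C ^+ 2).
  by move: psd0; congr (0 <= _); rewrite -/l2 -/l3 -/l4; field; rewrite gt_eqF.
have det1 : 0 <= l2 * l4 * (C ^+ 2 - e ^+ 2) - l3 ^+ 2 * C ^+ 2.
  by rewrite -(pmulr_rge0 _ L2).
have gap : l2 * l4 - l3 ^+ 2 <= l4 * ln 2.
  have : l4 * (l2 - l3) <= l4 * ln 2 by rewrite ler_pM2l// lerBlDl.
  have : l4 * l3 <= l3 ^+ 2 by rewrite expr2 ler_pM2r.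
  by lra.
rewrite -(ler_pM2l L4).
have : C ^+ 2 * (l2 * l4 - l3 ^+ 2) <= C ^+ 2 * (l4 * ln 2).
  by rewrite ler_wpM2l// sqr_ge0.
by lra.
Qed.

Theorem corollary3p5 (R : realType) :
  ~ equivalent_norms (holomorphic_near (@closed_unit_disc R))
      (dirichlet_mult_norm 2) (sup_norm (@unit_disc R)).
Proof.
move=> [c [D [c0 _ equiv]]].
(* If [c N1 <= N2 <= 2] then [N1 <= 2 / c]; the extra 1 makes the bound strict,
   so that some admissible constant lies below [M]. *)
pose M := 2 / c + 1.
have M0 : 0 < M by rewrite addr_gt0// divr_gt0.
pose e : R := expR (-1) - expR (-1) ^+ 2.
have e0 : 0 < e.
  by rewrite subr_gt0 expr2 gtr_pMl ?expR_gt0 ?expR_lt1 ?oppr_lt0//.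
have [n large] := neg_ln1m_unbounded (M ^+ 2 * ln 2 / e ^+ 2).
set s := expR (- n.+1%:R^-1) in large.
have s01 : 0 < s < 1 by rewrite /s expR_gt0 expR_lt1 oppr_lt0 invr_gt0 /=.
have sn : s ^+ n.+1 = expR (-1).
  by rewrite /s -expRM_natr mulNr mulVf.
have [le_mult _] := equiv _ (shifted_power_holomorphic n.+1 s _).
have sup2 : (sup_norm (@unit_disc R) (shifted_power n.+1 s) <= 2%:E)%E.
  by apply: shifted_power_sup_norm; case/andP: s01 => /ltW -> /ltW ->.
have multM : (dirichlet_mult_norm 2 (shifted_power n.+1 s) < M%:E)%E.
  apply: (@le_lt_trans _ _ (2 / c)%:E); last by rewrite lte_fin ltrDl.
  rewrite mulrC EFinM lee_pdivlMl//.
  exact: le_trans le_mult sup2.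
have [_ [C [C0 psd] <-]] := ereal_inf_lt multM.
rewrite lte_fin => CM.
have := two_point_bound s01 psd; rewrite sn -/e => bound.
move: large; rewrite ltr_pdivrMr ?exprn_gt0// mulrC => large.
have : C ^+ 2 * ln 2 <= M ^+ 2 * ln 2.
  by rewrite ler_wpM2r ?ln_ge0 ?ler1n// ler_sqr ?nnegrE// ltW.
move: large; rewrite [X in _ < X]mulrC.
by lra.
Qed.
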